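(* Let $G$ be a co-bipartite graph. Then $G$ is a circle graph if and only if $G$ contains no graph of the family $\mathcal{G}_{co}^p=\{\overline{C_{2k}} : k\ge 3\}\cup\{G_1,G_2,G_3\}$ as an induced subgraph.
   Context: All graphs are finite, undirected and simple. A graph is co-bipartite if its complement is bipartite; equivalently, its vertex set can be partitioned into two cliques. A graph is a circle graph if its vertices can be associated with chords of a circle so that two distinct vertices are adjacent if and only if the corresponding chords intersect. ''Contains $H$ as an induced subgraph'' means that some induced subgraph is isomorphic to $H$. The family $\mathcal{G}_{co}^p$ consists of the following graphs. $\overline{C_{2k}}$ (for $k\ge 3$) is the complement of the cycle on $2k$ vertices. Each of $G_1,G_2,G_3$ has vertex set $\{1,\dots,7\}$, in which $\{1,2,3\}$ and $\{4,5,6,7\}$ are cliques, and the edges between these two cliques are exactly: - $G_1$: $14,\ 25,\ 34,\ 35,\ 36$; - $G_2$: $24,\ 25,\ 34,\ 36$; - $G_3$: $15,\ 16,\ 24,\ 25,\ 34,\ 36$. *)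

(* Defs.v *)
From HB Require Import structures.
From mathcomp Require Import all_boot all_order all_algebra.
From mathcomp Require Import reals.

Set Implicit Arguments.
Unset Strict Implicit.
Unset Printing Implicit Defensive.

Import Order.TTheory GRing.Theory Num.Theory.

Record sgraph := SGraph {
  svertex :> finType;
  sedge : rel svertex;
  sedge_sym : symmetric sedge;
  sedge_irr : irreflexive sedge
}.

Notation "x -- y" := (sedge x y) (at level 30).

Section Operations.
Variable G : sgraph.

Definition compl_edge : rel G := [rel x y | (x != y) && ~~ (x -- y)].

Lemma compl_edge_sym : symmetric compl_edge.
Proof. by move=> x y; rewrite /compl_edge /= eq_sym sedge_sym. Qed.

Lemma compl_edge_irr : irreflexive compl_edge.
Proof. by move=> x; rewrite /compl_edge /= eqxx. Qed.

Definition compl : sgraph := SGraph compl_edge_sym compl_edge_irr.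

Variable S : {set G}.

Definition induced_edge : rel {x : G | x \in S} :=
  [rel x y | val x -- val y].

Lemma induced_edge_sym : symmetric induced_edge.
Proof. by move=> x y; rewrite /induced_edge /= sedge_sym. Qed.

Lemma induced_edge_irr : irreflexive induced_edge.
Proof. by move=> x; rewrite /induced_edge /= sedge_irr. Qed.

Definition induced : sgraph := SGraph induced_edge_sym induced_edge_irr.

End Operations.

Definition isomorphic (G H : sgraph) : Prop :=
  exists2 f : G -> H, bijective f & forall x y : G, (f x -- f y) = (x -- y).

Definition contains_induced (G H : sgraph) : Prop :=
  exists S : {set G}, isomorphic (induced S) H.

Definition bipartite (G : sgraph) : Prop :=
  exists A : {set G}, forall x y : G, x -- y -> (x \in A) != (y \in A).

Definition cobipartite (G : sgraph) : Prop := bipartite (compl G).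

(* [ordS] is the successor modulo n; the conjunct [i != j] only matters for
   n = 1, where it makes the relation irreflexive. *)
Definition cycle_edge (n : nat) : rel 'I_n :=
  [rel i j : 'I_n | (i != j) && ((ordS i == j) || (ordS j == i))].

Lemma cycle_edge_sym n : symmetric (@cycle_edge n).
Proof. by move=> i j; rewrite /cycle_edge /= eq_sym orbC. Qed.

Lemma cycle_edge_irr n : irreflexive (@cycle_edge n).
Proof. by move=> i; rewrite /cycle_edge /= eqxx. Qed.

Definition cycle_graph (n : nat) : sgraph :=
  SGraph (@cycle_edge_sym n) (@cycle_edge_irr n).

(* The graph on {1, ..., 7} in which {1, 2, 3} and {4, 5, 6, 7} are cliques and
   whose remaining edges are listed in E. The vertex k is encoded as the element
   k - 1 of 'I_7; the list E uses the labels 1, ..., 7. *)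
Definition clique34_edge (E : seq (nat * nat)) : rel 'I_7 :=
  [rel i j : 'I_7 | (i != j) &&
    [|| (i < 3) == (j < 3), (i.+1, j.+1) \in E | (j.+1, i.+1) \in E]].

Lemma clique34_edge_sym E : symmetric (clique34_edge E).
Proof.
move=> i j; rewrite /clique34_edge /= eq_sym [(i < 3) == _]eq_sym.
by congr (_ && (_ || _)); exact: orbC.
Qed.

Lemma clique34_edge_irr E : irreflexive (clique34_edge E).
Proof. by move=> i; rewrite /clique34_edge /= eqxx. Qed.

Definition clique34 (E : seq (nat * nat)) : sgraph :=
  SGraph (clique34_edge_sym E) (clique34_edge_irr E).

Definition G1 : sgraph := clique34 [:: (1, 4); (2, 5); (3, 4); (3, 5); (3, 6)].
Definition G2 : sgraph := clique34 [:: (2, 4); (2, 5); (3, 4); (3, 6)].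
Definition G3 : sgraph :=
  clique34 [:: (1, 5); (1, 6); (2, 4); (2, 5); (3, 4); (3, 6)].

Inductive Gcop : sgraph -> Prop :=
| Gcop_cocycle (k : nat) : 3 <= k -> Gcop (compl (cycle_graph (2 * k)))
| Gcop_G1 : Gcop G1
| Gcop_G2 : Gcop G2
| Gcop_G3 : Gcop G3.

Local Open Scope ring_scope.

Section Chords.
Variable R : realType.
Implicit Types (c p q z : R * R) (r : R).

Definition on_circle c r p : Prop :=
  (p.1 - c.1) ^+ 2 + (p.2 - c.2) ^+ 2 = r ^+ 2.

Definition on_segment p q z : Prop :=
  exists2 t : R, 0 <= t <= 1 &
    z = ((1 - t) * p.1 + t * q.1, (1 - t) * p.2 + t * q.2).

(* A chord is given by the pair of its endpoints. *)
Definition is_chord c r (d : (R * R) * (R * R)) : Prop :=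
  [/\ on_circle c r d.1, on_circle c r d.2 & d.1 != d.2].

Definition chords_meet (d d' : (R * R) * (R * R)) : Prop :=
  exists z, on_segment d.1 d.2 z /\ on_segment d'.1 d'.2 z.

Definition circle_graph (G : sgraph) : Prop :=
  exists c r (chord : G -> (R * R) * (R * R)),
    [/\ 0 < r, forall v, is_chord c r (chord v) &
        forall u v : G, u != v -> (u -- v <-> chords_meet (chord u) (chord v))].

End Chords.

(* Main.v *)
Require Import Defs.
From mathcomp Require Import all_boot reals.
From mathcomp Require Import all_order all_algebra ring lra zify.

(** Let [h] be the adjacency of the complement of [G], a bipartite graph.

Necessity. Read chords as closed intervals [[l, r]] of a line; two chords meet
iff their intervals overlap. The neighbors of [x] for [h] lie all inside or all
outside [[l x, r x]], so adjacent [x], [z] can be oriented by comparing the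
midpoints of their intervals, corrected by these two alternatives. Then [h x y]
with [z] adjacent to both forces opposite orientations of [(x, z)] and [(y, z)],
which is contradictory on each graph of the family.

Sufficiency. Choose in every component of [h] a vertex [x] such that some
component of the graph minus the closed neighborhood of [x] is as large as
possible. The forbidden subgraphs being excluded, the neighborhoods in the
previous and in the next layer (by distance from [x]) of the vertices of one
layer are nested, in opposite directions. Ordering first by layers and then by
these inclusions gives a linear order in which [u < v < w] and [h u w] imply
[h u v] or [h v w]. Completing it on the pairs of [h] in the two possible ways
(either side of the bipartition first) gives two linear orders; a chord joins
the position of [v] in the first, on one arc, to its position in the second, on
another arc. *)

Set Implicit Arguments.
Unset Strict Implicit.
Unset Printing Implicit Defensive.

(** * Bipartite graphs without the forbidden patterns *)

Lemma connect_invariant (T : finType) (e : rel T) (P : T -> Prop) x y :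
  connect e x y -> P x -> (forall a b, connect e x a -> P a -> e a b -> P b) -> P y.
Proof.
move=> /connectP[p pth ->] Px step.
elim/last_ind: p pth => [//|p z IH]; rewrite rcons_path last_rcons => /andP[pth ez].
by apply: step ez; [apply/connectP; exists p|exact: IH].
Qed.

Lemma lex_key (T : finType) (f g : T -> nat) :
  exists k : T -> nat, forall u v, (k u <= k v) = (f u < f v) || (f u == f v) && (g u <= g v).
Proof.
pose N := (\max_u g u).+1.
have gN u : g u < N by rewrite ltnS; exact: leq_bigmax.
exists (fun u => f u * N + g u) => u v.
have [fuv|fvu|->] /= := ltngtP (f u) (f v); last by rewrite leq_add2l.
- by have := gN u; have := leq_mul fuv (leqnn N); rewrite mulSn; clear; lia.
- by have := gN v; have := leq_mul fvu (leqnn N); rewrite mulSn; clear; lia.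
Qed.

Section Bipartite.
Variables (V : finType) (h : rel V) (A : {set V}).
Hypothesis h_sym : symmetric h.
Hypothesis h_bip : forall x y, h x y -> (x \in A) != (y \in A).

Lemma bip_irr x : h x x = false.
Proof. by apply/negP => /h_bip; rewrite eqxx. Qed.

Lemma side_flip x y : h x y -> (y \in A) = ~~ (x \in A).
Proof. by move/h_bip; do 2 case: (_ \in A). Qed.

Lemma same_side x y z : h x y -> h x z -> (y \in A) = (z \in A).
Proof. by move=> /side_flip-> /side_flip->. Qed.

Lemma same_side_nadj x y : (x \in A) = (y \in A) -> h x y = false.
Proof. by move=> e; apply/negP => /h_bip; rewrite e eqxx. Qed.

Lemma no_triangle x y z : h x y -> h x z -> h y z = false.
Proof. by move=> xy xz; apply/same_side_nadj/(same_side xy xz). Qed.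

(** An induced cycle of length [n]. For [n >= 5] these adjacencies already make its vertices
    distinct, so injectivity is not stated. *)
Definition is_hole (n : nat) (f : nat -> V) : Prop :=
  forall i j, i < j < n -> h (f i) (f j) = (j == i.+1) || (i == 0) && (j == n.-1).

(* The complements of [G1], [G2], [G3]: [a, b, c] stand for the vertices 1, 2, 3
   and [d, e, f, g] for 4, 5, 6, 7. *)
Definition pattern1 (a b c d e f g : V) : bool :=
  [&& ~~ h a d, h a e, h a f, h a g,
      h b d, ~~ h b e, h b f, h b g,
      ~~ h c d, ~~ h c e, ~~ h c f & h c g].

Definition pattern2 (a b c d e f g : V) : bool :=
  [&& h a d, h a e, h a f, h a g,
      ~~ h b d, ~~ h b e, h b f, h b g,
      ~~ h c d, h c e, ~~ h c f & h c g].

Definition pattern3 (a b c d e f g : V) : bool :=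
  [&& h a d, ~~ h a e, ~~ h a f, h a g,
      ~~ h b d, ~~ h b e, h b f, h b g,
      ~~ h c d, h c e, ~~ h c f & h c g].

Hypothesis no_hole : forall n f, 5 <= n -> ~ is_hole n f.

(** Chords shorten the walk. A chordless one with a single interior vertex gives [z]; a longer one
    closes up through [w] into a hole, as [w] sees only its two ends. *)
Lemma walk_common_neighbor (S : pred V) w p q n (d : nat -> V) :
  (forall z, S z -> (z != w) && ~~ h w z) -> h w p -> h w q ->
  d 0 = p -> d n.+2 = q ->
  (forall i, i <= n -> S (d i.+1)) -> (forall i, i <= n.+1 -> h (d i) (d i.+1)) ->
  exists2 z, S z & h p z && h q z.
Proof.
move=> Sw wp wq; elim/ltn_ind: n d => n IH d d0 dn Sd dd.
have pq : h p q = false by exact: no_triangle wp wq.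
have [|/existsPn chordless] := boolP [exists i : 'I_n.+3, exists j : 'I_n.+3,
    (i.+1 < j) && h (d i) (d j)].
  case/existsP=> i /existsP[j /andP[ij dij]].
  have jn := ltn_ord j.
  (* The shortcut keeps an interior vertex: only a chord from [p] to [q] would leave none, and these
     have the common neighbor [w]. *)
  have kn : j - i.+1 <= n.
    rewrite leqNgt; apply/negP => nk; have [i0 j0] : i = 0 :> nat /\ j = n.+2 :> nat by lia.
    by move: dij; rewrite i0 j0 d0 dn pq.
  pose k := j - i.+1; pose d' m := if m <= i then d m else d (m + k).
  apply: (IH (n - k) _ d'); rewrite /d' //=; first by lia.
  - by rewrite leqNgt (_ : _ < _) -?dn; [congr d|]; lia.
  - by move=> m mk; case: ifP => _; [|rewrite addSn]; apply: Sd; lia.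
  move=> m mk; case: (ltngtP m i) => [mi|mi|->].
  - by apply: dd; lia.
  - by rewrite addSn; apply: dd; lia.
  - by rewrite (_ : i.+1 + k = j) //; lia.
have {}chordless i j : i.+1 < j <= n.+2 -> h (d i) (d j) = false.
  move=> ij; have [i3 j3] : i < n.+3 /\ j < n.+3 by lia.
  have /existsPn/(_ (Ordinal j3)) := chordless (Ordinal i3).
  by rewrite /= (_ : i.+1 < j) ?(negbTE) //; lia.
case: n d d0 dn Sd dd chordless {IH} => [|n] d d0 dn Sd dd chordless.
  exists (d 1); first exact: Sd.
  by rewrite -d0 -dn dd // h_sym dd.
case: (@no_hole n.+4.+1 (fun m => if m is m'.+1 then d m' else w)) => // -[|i] [|j] //= ijn.
  have [->|j0] := posnP j; first by rewrite d0 wp.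
  have [->|jn] := eqVneq j n.+3; first by rewrite dn wq eqxx.
  have /Sw/andP[_ /negbTE] : S (d j) by rewrite -(prednK j0); apply: Sd; lia.
  by move=> ->; lia.
have [->|ij] := eqVneq j i.+1; first by rewrite dd ?eqxx //; lia.
by rewrite chordless; lia.
Qed.

Definition restrict (S : pred V) : rel V := [rel a b | [&& S a, S b & h a b]].

Lemma restrict_sym S : symmetric (restrict S).
Proof. by move=> a b; rewrite /restrict /= h_sym andbCA. Qed.

Lemma restrict_connect_sym S : connect_sym (restrict S).
Proof. exact/sym_connect_sym/restrict_sym. Qed.

(* Without a hole, a shortest walk through [S] closes with [w] into a 4-cycle. *)
Lemma common_neighbor (S : pred V) w p q a b :
  (forall z, S z -> (z != w) && ~~ h w z) -> h w p -> h w q ->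
  S a -> h p a -> h b q -> connect (restrict S) a b ->
  exists2 z, S z && connect (restrict S) a z & h p z && h q z.
Proof.
move=> Sw wp wq Sa pa bq /connectP[s pth eb].
have allS : all S (a :: s).
  rewrite /= Sa; elim: s a pth {eb pa Sa} => //= c s IH a /andP[/and3P[_ Sc _] /IH->].
  by rewrite Sc.
have subS z : z \in a :: s -> S z by exact: (allP allS).
have [||i i_s|i|z z_s pqz] := @walk_common_neighbor (mem (a :: s)) w p q (size s)
  (fun m => if m is m'.+1 then nth q (a :: s) m' else p) _ wp wq erefl; last first.
- by exists z => //; rewrite subS // (path_connect pth).
- case: i => [|i] i_s //=; move: i_s; rewrite ltnS leq_eqVlt => /orP[/eqP->|i_s].
    by rewrite (nth_default q (leqnn _)) (set_nth_default a) //= -last_nth -eb.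
  by have /and3P[] := pathP q pth i i_s.
- exact: mem_nth.
- by rewrite /= nth_default.
- by move=> z /subS/Sw.
Qed.

Hypothesis no_pattern1 : forall a b c d e f g, ~~ pattern1 a b c d e f g.
Hypothesis no_pattern2 : forall a b c d e f g, ~~ pattern2 a b c d e f g.
Hypothesis no_pattern3 : forall a b c d e f g, ~~ pattern3 a b c d e f g.

(** * Connectivity among the non-neighbors of a vertex *)

Definition away (x : V) : pred V := [pred z | (z != x) && ~~ h x z].

(** Only the target must be a neighbor of [w]; a walk started at a neighbor of [w] then stays among
    them. *)
Definition linked (x w : V) : rel V :=
  [rel a b | h w b && [exists t, [&& ~~ h x t, h a t & h t b]]].

(** Cut the walk from [a] to [b] at its visits to the neighborhood of [w]. Each piece in between
    avoids [w] and its neighbors, so [common_neighbor] replaces it by one middle vertex. *)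
Lemma away_linked x w a b : h x w -> h w a -> h w b -> away x a ->
  connect (restrict (away x)) a b -> connect (linked x w) a b.
Proof.
move=> xw wa wb xa ab.
pose S' : pred V := [pred z | away x z && ~~ h w z].
have S'w z : S' z -> (z != w) && ~~ h w z.
  by case/andP=> /andP[_ xz] ->; rewrite andbT; apply: contraNneq xz => ->.
(* At a non-neighbor [y] of [w], the invariant remembers the last neighbor [c] of [w] on the walk
   and the vertex [d] after it. *)
pose P y := if h w y then connect (linked x w) a y else
  [exists c, [exists d, [&& h w c, connect (linked x w) a c, S' d, h c d &
                           connect (restrict S') d y]]].
suff : P b by rewrite /P wb.
apply: (connect_invariant (P := fun y => P y) ab); first by rewrite /P wa connect0.
move=> y z _ Py /and3P[xy xz yz]; move: Py; rewrite /P.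
have [wy ay|wy /existsP[c /existsP[d /and5P[wc ac xd cd dy]]]] := boolP (h w y).
  have wz : h w z = false.
    by apply: contraTF yz => wz; rewrite (no_triangle wy wz).
  rewrite wz; apply/existsP; exists y; apply/existsP; exists z.
  have S'z : S' z by apply/andP; rewrite wz.
  by rewrite wy ay S'z yz connect0.
have S'y : S' y by apply/andP.
have [wz|wz] := boolP (h w z).
  have [t /andP[/andP[/andP[_ xt] _] _] /andP[ct zt]] :=
    common_neighbor S'w wc wz xd cd yz dy.
  apply: connect_trans ac (connect1 _); rewrite /linked /= wz; apply/existsP; exists t.
  by rewrite xt ct h_sym.
apply/existsP; exists c; apply/existsP; exists d; rewrite wc ac xd cd /=.
by apply: connect_trans dy (connect1 _); apply/and3P; split=> //; apply/andP.
Qed.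

(** Shorten a linked walk whose first vertex [p] sees [u] and whose last vertex sees [v]. The vertex
    after [p] replaces [p] if it sees [u]; otherwise [pattern1] makes its neighbors not adjacent to
    [x] neighbors of [p], so it can be skipped. A vertex seeing both [u] and [v] gives
    [pattern2]. *)
Lemma no_fork_far x w p q u v : h x w -> h w p -> h w q -> away x p ->
  connect (restrict (away x)) p q ->
  h p u -> ~~ h q u -> h q v -> ~~ h p v -> ~~ h x u -> ~~ h x v -> False.
Proof.
move=> xw wp wq xp pq pu qu qv pv xu xv.
have no_both b : h w b -> h b u -> h b v -> False.
  move=> wb bu bv; have /negP[] := no_pattern2 w u v x q p b; rewrite /pattern2.
  rewrite !(h_sym u) !(h_sym v) (h_sym w x) xw wq wp wb.
  by rewrite xu qu pu bu xv qv pv bv.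
have {pq}/connectP[s pth eq] := away_linked xw wp wq xp pq.
have {eq qv} : h (last p s) v by rewrite -eq.
move: wp pu pth {pv xp}; move: {2}(size s) (leqnn (size s)) => n.
elim: n s p => [|n IH] [|a s] p //= sn wp pu; try by move=> _; exact: no_both.
case/andP=> /andP[wa /existsP[t /and3P[xt pt ta]]] pth la.
have third r : h a r -> ~~ h p r -> ~~ h x r -> ~~ h a u -> False.
  move=> ar pr xr au; have /negP[] := no_pattern1 p a x r u t w; rewrite /pattern1.
  by rewrite pr pu pt (h_sym p w) wp ar au (h_sym a t) ta (h_sym a w) wa xr xu xt xw.
have [au|au] := boolP (h a u); first exact: IH pth la.
have [av|av] := boolP (h a v).
  by apply: (third v) => //; apply/negP => pv; exact: no_both wp pu pv.
case: s sn pth la => [|b s] /= sn; first by rewrite (negbTE av).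
case/andP=> /andP[wb /existsP[r /and3P[xr ar rb]]] pth la.
have [pr|pr] := boolP (h p r); last exact: (third r).
apply: (IH (b :: s) p) la => //=; rewrite pth andbT; apply/andP; split=> //.
by apply/existsP; exists r; rewrite xr pr.
Qed.

(** A common neighbor [z] of [p] and [q] turns the connection into a walk of two-edge steps among
    neighbors of [p] or [q]. It cannot jump from a vertex seeing only [p] to one seeing only [q],
    and a vertex seeing both can be skipped, by [pattern2]. *)
Lemma no_fork_near x p q u v : h x p -> h x q -> away x u ->
  connect (restrict (away x)) u v ->
  h p u -> ~~ h q u -> h q v -> ~~ h p v -> False.
Proof.
move=> xp xq xu uv pu qu qv pv.
have [z /andP[xz uz] /andP[pz qz]] :
    exists2 z, away x z && connect (restrict (away x)) u z & h p z && h q z.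
  by apply: (common_neighbor _ xp xq xu pu _ uv) => //; rewrite h_sym.
have vz : connect (restrict (away x)) z v.
  by apply: connect_trans uv; rewrite restrict_connect_sym.
pose E : rel V := [rel a b | (h p b || h q b) && [exists t, [&& ~~ h x t, h a t & h t b]]].
have : connect E u v.
  apply: (@connect_trans _ _ z).
    apply: connect_sub (away_linked xp pu pz xu uz) => a b /andP[pb ab].
    by apply: connect1; rewrite /E /= pb.
  apply: connect_sub (away_linked xq qz qv xz vz) => a b /andP[pb ab].
  by apply: connect1; rewrite /E /= pb orbT.
case/connectP=> s pth ev; move: qv pv; rewrite {}ev => qv pv {uv vz uz xu}.
move: pu qu pth qv pv; move: {2}(size s) (leqnn (size s)) => n.
elim: n s u => [|n IH] [|a s] u //= sn pu qu; try by rewrite (negbTE qu).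
case/andP=> /andP[pqa /existsP[t /and3P[xt ut ta]]] pth ql pl.
have [qa|qa] := boolP (h q a); last first.
  by move: pqa; rewrite (negbTE qa) orbF => pa; exact: IH pth ql pl.
have [pa|pa] := boolP (h p a); last first.
  have xpart y : h p y || h q y -> (y \in A) = (x \in A).
    by case/orP=> [py|qy]; [apply: (@same_side p)|apply: (@same_side q)]; rewrite // h_sym.
  have xu : h x u = false by apply: same_side_nadj; rewrite xpart ?pu.
  have xa : h x a = false by apply: same_side_nadj; rewrite xpart // qa orbT.
  have pt : h p t = false by apply: (@no_triangle u); rewrite // h_sym.
  (* Otherwise [x], [p], [u], [t], [a], [q] form a hole: none of [u], [t], [a] is a common neighbor
     of [p] and [q]. *)
  have [||||y] := @common_neighbor (mem [:: u; t; a]) x p q u a _ xp xq _ pu.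
  - move=> y; rewrite !inE => /or3P[]/eqP->.
    + by rewrite xu andbT; apply: contraNneq qu => ->; rewrite h_sym.
    + by rewrite xt andbT; apply: contraFneq xu => <-; rewrite h_sym.
    + by rewrite xa andbT; apply: contraNneq pa => ->; rewrite h_sym.
  - by rewrite !inE eqxx.
  - by rewrite h_sym.
  - by apply: (@connect_trans _ _ t); apply: connect1;
      rewrite /restrict /= !inE !eqxx ?orbT /= ?ut ?ta.
  rewrite !inE => /andP[/or3P[]/eqP-> _].
  - by rewrite (negbTE qu) andbF.
  - by rewrite pt.
  - by rewrite (negbTE pa).
case: s sn pth ql pl => [|b s] /= sn; first by rewrite pa.
case/andP=> /andP[pqb /existsP[r /and3P[xr ar rb]]] pth ql pl.
have [ur|ur] := boolP (h u r).
  apply: (IH (b :: s) u) ql pl => //=; rewrite pth andbT; apply/andP; split=> //.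
  by apply/existsP; exists r; rewrite xr ur.
have /negP[] := no_pattern2 a x u r t q p; rewrite /pattern2.
by rewrite ar (h_sym a t) ta !(h_sym a) qa pa xr xt xq xp ur ut !(h_sym u) qu pu.
Qed.

(** * Nested neighborhoods between consecutive layers *)

Section Layers.
Variables (x : V) (C : pred V) (lev : V -> nat).
Hypothesis C_closed : forall y z, C y -> h y z -> C z.
(* [lia] would case-split on every boolean hypothesis of the context. *)
Ltac levlia :=
  repeat match goal with
  | H : context [h] |- _ => clear H
  | H : context [C] |- _ => clear H
  | H : context [away] |- _ => clear H
  end; lia.

Hypothesis lev_root : forall y, C y -> lev y = 0 -> y = x.
Hypothesis lev_adj : forall y z, C y -> h y z -> lev z = (lev y).+1 \/ lev y = (lev z).+1.
Hypothesis lev_up : forall y, C y -> 0 < lev y -> exists2 z, h y z & lev y = (lev z).+1.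
Hypothesis away_connected : forall y z a b, C y -> C z -> away x y -> away x z ->
  h x a != h y a -> h x b != h z b -> connect (restrict (away x)) y z.

Lemma lev_nadj y z : C y -> lev z != (lev y).+1 -> lev y != (lev z).+1 -> ~~ h y z.
Proof. by move=> Cy nyz nzy; apply/negP => /(lev_adj Cy)[]/eqP; apply/negP. Qed.

Lemma lev1_adj y : C y -> lev y = 1 -> h x y.
Proof.
move=> Cy y1; have [|z yz] := lev_up Cy; rewrite y1 // => -[] /esym z0.
by rewrite h_sym -(lev_root (C_closed Cy yz) z0).
Qed.

Lemma root_adj_lev y : C x -> lev x = 0 -> h x y -> lev y = 1.
Proof. by move=> Cx x0 /(lev_adj Cx)[]; rewrite x0. Qed.

Lemma lev_away y : C x -> lev x = 0 -> C y -> 1 < lev y -> away x y.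
Proof.
move=> Cx x0 Cy y1; rewrite /away /=; apply/andP; split.
  by apply: contraTneq y1 => ->; rewrite x0.
by apply: contraTN y1 => /(root_adj_lev Cx x0) ->.
Qed.

Hypotheses (Cx : C x) (lev_x : lev x = 0).

Lemma layer_no_2K2 u v p q : C u -> C v -> lev u = lev v ->
  h u p -> lev u = (lev p).+1 -> h v q -> lev v = (lev q).+1 ->
  ~~ h u q -> ~~ h v p -> False.
Proof.
move: {2}(lev p) (erefl (lev p)) => i.
elim: i u v p q => [|i IH] u v p q pi Cu Cv uv up ulp vq vlq uq vp.
  have q0 : lev q = 0 by levlia.
  have Cp := C_closed Cu up; have Cq := C_closed Cv vq.
  by move: uq; rewrite (lev_root Cq q0) -(lev_root Cp pi) up.
have Cp := C_closed Cu up; have Cq := C_closed Cv vq.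
have pq : lev p = lev q by levlia.
have [u2 v2] : 1 < lev u /\ 1 < lev v by levlia.
have ux := lev_away Cx lev_x Cu u2; have vx := lev_away Cx lev_x Cv v2.
have [xu xv] : ~~ h x u /\ ~~ h x v by case/andP: ux; case/andP: vx.
have [i0|i0] := posnP i.
  have xp : h x p by apply: lev1_adj => //; levlia.
  have xq : h x q by apply: lev1_adj => //; levlia.
  apply: (@no_fork_near x p q u v); rewrite // 1?h_sym // 1?h_sym //.
  by apply: (@away_connected u v q p) => //; rewrite ?xp ?xq ?(negbTE uq) ?(negbTE vp).
have [w [pw qw lw]] : exists w, [/\ h p w, h q w & lev p = (lev w).+1].
  have [|a pa la] := lev_up Cp; first by levlia.
  have [|b qb lb] := lev_up Cq; first by levlia.
  have [qa|qa] := boolP (h q a); first by exists a.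
  have [pb|pb] := boolP (h p b); first by exists b; split=> //; levlia.
  by case: (IH p q a b) => //; levlia.
have Cw := C_closed Cp pw.
have px : away x p by apply: lev_away => //; levlia.
have qx : away x q by apply: lev_away => //; levlia.
have [i1|i1] := eqVneq i 1.
  have xw : h x w by apply: lev1_adj => //; levlia.
  apply: (@no_fork_far x w p q u v); rewrite // 1?h_sym // .
  by apply: (@away_connected p q u v) => //; rewrite ?(h_sym p) ?up ?(h_sym q) ?vq
    ?(negbTE xu) ?(negbTE xv).
have [|a wa la] := lev_up Cw; first by levlia.
have Ca := C_closed Cw wa.
have [|b ab lb] := lev_up Ca; first by levlia.
have Cb := C_closed Ca ab.
have /negP[] := no_pattern3 p q a u b v w; rewrite /pattern3.
have pb : ~~ h p b by apply: lev_nadj => //; levlia.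
have qb : ~~ h q b by apply: lev_nadj => //; levlia.
have au : ~~ h a u by apply: lev_nadj => //; levlia.
have av : ~~ h a v by apply: lev_nadj => //; levlia.
by rewrite (h_sym p u) up pb (h_sym p v) vp pw (h_sym q u) uq qb (h_sym q v) vq qw au ab av
  (h_sym a w) wa.
Qed.

(** This makes the inclusions towards the previous and the next layer run in opposite directions. A
    neighbor [a] of [v] closer to [x] is shared by [u]; [pattern2] arises when [p] is at level 1,
    [pattern1] farther out. *)
Lemma layer_no_skew u v p q : C u -> C v -> lev u = lev v ->
  h u p -> lev u = (lev p).+1 -> h u q -> lev q = (lev u).+1 ->
  ~~ h v p -> ~~ h v q -> False.
Proof.
move=> Cu Cv uv up ulp uq ulq vp vq.
have [|a va la] := lev_up Cv; first by levlia.
have ua : h u a.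
  by apply/negPn/negP => ua; apply: (@layer_no_2K2 u v p a) => //; levlia.
have Cp := C_closed Cu up; have Ca := C_closed Cu ua; have Cq := C_closed Cu uq.
have [p0|p0] := posnP (lev p).
  by move: vp; rewrite (lev_root Cp p0) -(@lev_root a) ?va //; levlia.
have [p1|p1] := eqVneq (lev p) 1.
  have xp : h x p by apply: lev1_adj.
  have xa : h x a by apply: lev1_adj => //; levlia.
  have ux : away x u by apply: lev_away => //; levlia.
  have vx : away x v by apply: lev_away => //; levlia.
  have xq : ~~ h x q by apply: lev_nadj => //; levlia.
  have neuv : u != v by apply: contraNneq vp => <-.
  (* The choice of [x] connects [v] to [u] away from [x], which gives [v] a neighbor in the next
     layer. *)
  have [c xc vc] : exists2 c, away x c & h v c.
    have : connect (restrict (away x)) v u.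
      apply: (@away_connected v u p q) => //.
        by rewrite xp (negbTE vp).
      by rewrite uq (negbTE xq).
    case/connectP=> -[|c s] /= pth e; first by rewrite e eqxx in neuv.
    by case/andP: pth => /and3P[_ xc vc] _; exists c.
  have Cc := C_closed Cv vc.
  have lc : lev c = (lev v).+1.
    case: (lev_adj Cv vc) => // lvc; case/andP: xc => _ /negP[].
    by apply: lev1_adj => //; levlia.
  have uc : h u c.
    apply/negPn/negP => uc; apply: (@layer_no_2K2 q c u v) => //; rewrite 1?h_sym //; levlia.
  have /negP[] := no_pattern2 u v x q p c a; rewrite /pattern2.
  rewrite uq up uc ua vq vp vc va xq xp xa /=.
  by case/andP: xc => _ ->.
have [w [pw aw lw]] : exists w, [/\ h p w, h a w & lev p = (lev w).+1].
  have [//|b pb lb] := lev_up Cp.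
  have [|c ac lc] := lev_up Ca; first by levlia.
  have [ab|ab] := boolP (h a b); first by exists b.
  have [pc|pc] := boolP (h p c); first by exists c; split=> //; levlia.
  by case: (@layer_no_2K2 p a b c) => //; levlia.
have Cw := C_closed Cp pw.
have [|b wb lb] := lev_up Cw; first by levlia.
have wq : ~~ h w q by apply: lev_nadj => //; levlia.
have ub : ~~ h u b by apply: lev_nadj => //; levlia.
have vb : ~~ h v b by apply: lev_nadj => //; levlia.
have /negP[] := no_pattern1 w u v q b p a; rewrite /pattern1.
by rewrite wq wb (h_sym w p) pw (h_sym w a) aw uq ub up ua vq vb vp va.
Qed.

Definition up_nbrs y := [set z | h y z && (lev y == (lev z).+1)].
Definition down_nbrs y := [set z | h y z && (lev z == (lev y).+1)].
(** Grows with the degree into the next layer and decreases with the degree into the previous one;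
    the difference is never truncated. *)
Definition score y := #|down_nbrs y| + (#|V| - #|up_nbrs y|).

(** Both families of neighborhoods are chains, and by [layer_no_skew] a strict inclusion in one
    forces the reverse weak inclusion in the other. So the two terms of the score never
    compensate. *)
Lemma score_nested u v : C u -> C v -> lev u = lev v -> score u <= score v ->
  (up_nbrs v \subset up_nbrs u) && (down_nbrs u \subset down_nbrs v).
Proof.
move=> Cu Cv uv; rewrite /score => suv.
have up_chain p : p \in up_nbrs v -> p \notin up_nbrs u -> up_nbrs u \subset up_nbrs v.
  rewrite !inE -uv => /andP[vp lp]; rewrite lp andbT => up.
  apply/subsetP => q; rewrite !inE -uv => /andP[uq lq]; rewrite lq andbT.
  by apply/negPn/negP => vq; apply: (@layer_no_2K2 u v q p) => //; levlia.
have down_chain q : q \in down_nbrs u -> q \notin down_nbrs v -> down_nbrs v \subset down_nbrs u.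
  rewrite !inE -uv => /andP[uq lq]; rewrite lq andbT => vq.
  apply/subsetP => p; rewrite !inE -uv => /andP[vp lp]; rewrite lp andbT.
  have [Cp Cq] := (C_closed Cv vp, C_closed Cu uq).
  apply/negPn/negP => up; apply: (@layer_no_2K2 q p u v); rewrite // 1?h_sym //; levlia.
have skew a b p q : C a -> C b -> lev a = lev b -> p \in up_nbrs a -> q \in down_nbrs a ->
    p \notin up_nbrs b -> q \notin down_nbrs b -> False.
  rewrite !inE => Ca Cb ab /andP[ap lp] /andP[aq lq]; rewrite -ab lp lq !andbT.
  by apply: (@layer_no_skew a b p q) => //; apply/eqP.
have upV y : #|up_nbrs y| <= #|V| by exact: max_card.
apply/andP; split; apply/subsetP => y; apply: contraLR => yN; apply/negP => yI; move: suv;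
  apply/negP; rewrite -ltnNge.
- have lt_up : #|up_nbrs u| < #|up_nbrs v|.
    by apply: proper_card; apply/properP; split; [exact: up_chain yI yN|exists y].
  suff /subset_leq_card : down_nbrs v \subset down_nbrs u.
    by have := upV v; levlia.
  apply/subsetP => q qv; apply/negPn/negP => qu.
  exact: (skew v u y q).
- have lt_down : #|down_nbrs v| < #|down_nbrs u|.
    by apply: proper_card; apply/properP; split; [exact: down_chain yI yN|exists y].
  suff /subset_leq_card : up_nbrs u \subset up_nbrs v.
    by have := upV u; levlia.
  apply/subsetP => p pu; apply/negPn/negP => pv.
  exact: (skew u v p y).
Qed.

(** An edge joins consecutive layers, so [v] shares the layer of [u] or of [w], and [score_nested]
    hands the edge over to [v]. *)
Lemma layer_cocomparability u v w : C u -> C v -> C w ->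
  (lev u < lev v) || (lev u == lev v) && (score u <= score v) ->
  (lev v < lev w) || (lev v == lev w) && (score v <= score w) ->
  h u w -> h u v || h v w.
Proof.
move=> Cu Cv Cw uv vw huw.
have lwu : lev w = (lev u).+1 by case: (lev_adj Cu huw) => // ?; levlia.
case/orP: uv => [uv|/andP[/eqP uv suv]].
  have vw' : lev v = lev w by levlia.
  have /andP[/subsetP sub _] : (up_nbrs w \subset up_nbrs v) && (down_nbrs v \subset down_nbrs w).
    by apply: score_nested => //; levlia.
  have /sub : u \in up_nbrs w by rewrite inE h_sym huw lwu eqxx.
  by rewrite inE h_sym => /andP[->].
have /andP[_ /subsetP sub] := score_nested Cu Cv uv suv.
have /sub : w \in down_nbrs u by rewrite inE huw lwu eqxx.
by rewrite inE => /andP[->]; rewrite orbT.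
Qed.

End Layers.

(** * Distance layers and the choice of their root *)

Lemma h_connect_sym : connect_sym h.
Proof. exact: sym_connect_sym. Qed.

(** [lev] is the distance from [x]. Its parity determines the side, so no edge stays inside a
    layer. *)
Lemma levels_exist x : exists lev : V -> nat, [/\ lev x = 0,
  forall y, connect h x y -> lev y = 0 -> y = x,
  forall y z, connect h x y -> h y z -> lev z = (lev y).+1 \/ lev y = (lev z).+1 &
  forall y, connect h x y -> 0 < lev y -> exists2 z, h y z & lev y = (lev z).+1].
Proof.
pose ball n := iter n (fun B => B :|: [set z | [exists y in B, h y z]]) [set x].
have ballS n z : (z \in ball n.+1) = (z \in ball n) || [exists y in ball n, h y z].
  by rewrite /= !inE.
have [lev levP] : exists lev : V -> nat, forall y, connect h x y ->
    y \in ball (lev y) /\ forall n, y \in ball n -> lev y <= n.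
  apply: (@fin_all_exists _ (fun _ => nat) (fun y m => connect h x y ->
    y \in ball m /\ forall n, y \in ball n -> m <= n)) => y.
  have [xy|] := boolP (connect h x y); last by exists 0.
  have ex : exists n, y \in ball n.
    apply: (connect_invariant (P := fun y => exists n, y \in ball n) xy)
      => [|a b _ [n an] ab]; first by exists 0; rewrite inE.
    exists n.+1; rewrite ballS; apply/orP; right; apply/existsP; exists a.
    exact/andP.
  by exists (ex_minn ex) => _; case: ex_minnP.
have lev_step y z : connect h x y -> h y z -> lev z <= (lev y).+1.
  move=> xy yz; have [yb _] := levP y xy.
  have [_ ->] // := levP z (connect_trans xy (connect1 yz)).
  by rewrite ballS; apply/orP; right; apply/existsP; exists y; rewrite yb.
have lev_up y : connect h x y -> 0 < lev y -> exists2 z, h y z & lev y = (lev z).+1.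
  move=> xy y0; have [yb ymin] := levP y xy.
  move: yb; rewrite -(prednK y0) ballS; case/orP => [/ymin|].
    by case: (lev y) y0 => //= n _; rewrite ltnn.
  case/existsP=> z /andP[zb zy]; exists z; first by rewrite h_sym.
  have xz : connect h x z by apply: connect_trans xy (connect1 _); rewrite h_sym.
  have [_ /(_ _ zb) zmin] := levP z xz.
  by have := lev_step _ _ xz zy; move: zmin y0; clear; lia.
have lev0 y : connect h x y -> lev y = 0 -> y = x.
  by move=> xy y0; have [] := levP y xy; rewrite y0 inE => /eqP.
have parity y : connect h x y -> (y \in A) = (x \in A) (+) odd (lev y).
  move: {2}(lev y) (erefl (lev y)) => n; elim: n y => [|n IH] y yn xy.
    by rewrite yn (lev0 y xy yn) addbF.
  have [|z yz] := lev_up y xy; first by rewrite yn.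
  rewrite yn => -[zn]; rewrite (side_flip (_ : h z y)) 1?h_sym // (IH z) //.
    by rewrite -zn /=; case: (_ \in A); case: (odd _).
  exact: connect_trans xy (connect1 yz).
exists lev; split=> //.
  by have [_ /(_ 0)] := levP x (connect0 _ _); rewrite inE eqxx leqn0 => /(_ isT)/eqP.
move=> y z xy yz; have xz := connect_trans xy (connect1 yz).
have := h_bip yz; rewrite (parity y xy) (parity z xz).
have := lev_step _ _ xy yz; have := lev_step z y xz; rewrite h_sym yz => /(_ isT).
case: (x \in A) => /=; clear; lia.
Qed.

(* Choose [x] and a component [D] of the vertices away from [x] with [D] largest:
   then every vertex of the component of [x] outside [D] and away from [x] has the
   same neighbors as [x]. *)
Lemma extremal_vertex x0 : exists2 x, connect h x0 x &
  forall y z a b, connect h x y -> connect h x z -> away x y -> away x z ->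
  h x a != h y a -> h x b != h z b -> connect (restrict (away x)) y z.
Proof.
pose good (i : V * V) := [&& connect h x0 i.1, connect h x0 i.2 & away i.1 i.2].
pose comp (i : V * V) := [set y | connect (restrict (away i.1)) i.2 y].
have [/existsP[i0 gi0]|/existsPn none] := boolP [exists i, good i]; last first.
  exists x0 => // y z a b xy _ y_away _ _ _.
  by have := none (x0, y); rewrite /good /= connect0 xy /=; move/negP; case.
case: (@arg_maxnP _ i0 good (fun i => #|comp i|) gi0) => -[x c] /and3P[/= x0x x0c xc] max.
pose D := comp (x, c).
have xC y : connect h x y -> connect h x0 y by exact: connect_trans.
have D_closed a b : a \in D -> away x a -> away x b -> h a b -> b \in D.
  rewrite !inE => ca xa xb ab; apply: connect_trans ca (connect1 _).
  exact/and3P.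
have D_away a : a \in D -> away x a.
  rewrite inE => ca.
  by apply: (connect_invariant (P := fun y => away x y) ca xc) => a' b _ _ /and3P[].
have cD : c \in D by rewrite inE connect0.
(* If [z] missed a vertex [b] on the boundary of [D], then [D] together with [b] would be connected
   away from [z], against the maximality of [D]. *)
have anticomplete z : connect h x0 z -> z \notin D -> (forall d, d \in D -> ~~ h z d) ->
    forall d b, d \in D -> h d b -> b \notin D -> h z b.
  move=> x0z zD zd d b dD db bD; apply/negPn/negP => zb.
  have D_away_z a : a \in D -> away z a.
    by move=> aD; apply/andP; split; [apply: contraNneq zD => <-|exact: zd].
  have sub : D \subset comp (z, c).
    apply/subsetP => a aD; move: (aD); rewrite !inE /= => ca.
    apply: (connect_invariant (P := fun y => connect (restrict (away z)) c y) ca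
      (connect0 _ _)) => e f ce zce /and3P[xe xf ef].
    have eD : e \in D by rewrite inE.
    apply: connect_trans zce (connect1 _); apply/and3P; split=> //; apply: D_away_z => //.
    exact: D_closed ef.
  have /eqP eqD : D == comp (z, c).
    rewrite eqEcard sub; apply: (max (z, c)).
    by apply/and3P; split=> //; exact: D_away_z.
  move/negP: bD; apply; have := dD; rewrite eqD !inE /= => zcd.
  apply: connect_trans zcd (connect1 _); apply/and3P; split=> //; first exact: D_away_z.
  by rewrite /away /= zb andbT; apply: contraTneq db => ->; rewrite h_sym zd.
have xD : x \notin D by apply/negP => /D_away/andP[]; rewrite eqxx.
have xd d : d \in D -> ~~ h x d by move=> /D_away/andP[].
have [d0 [b0 [d0D b0D db0]]] : exists d0 b0, [/\ d0 \in D, b0 \notin D & h d0 b0].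
  have cx : connect h c x.
    by apply: (@connect_trans _ _ x0); rewrite // h_connect_sym.
  have [/existsP[d /existsP[b /and3P[? ? ?]]]|/existsPn none] :=
    boolP [exists d, exists b, [&& d \in D, b \notin D & h d b]]; first by exists d, b.
  case/negP: xD; apply: (connect_invariant (P := fun y => y \in D) cx cD) => a b _ aD ab.
  by have /existsPn/(_ b) := none a; rewrite aD ab andbT negbK.
(* If [b] has a neighbor in [D], it is on the boundary of [D]. If not, [anticomplete] applies to [b]
   too, and [z], [b], [b0] form a triangle. *)
have same z z' b : connect h x0 z -> z \notin D -> (forall d, d \in D -> ~~ h z d) ->
    connect h x0 z' -> z' \notin D -> (forall d, d \in D -> ~~ h z' d) -> h z b -> h z' b.
  move=> x0z zD zd x0z' z'D z'd zb.
  have bD : b \notin D by apply: contraTN zb => /zd.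
  have [/existsP[d /andP[dD db]]|/existsPn none] := boolP [exists d, (d \in D) && h d b].
    exact: anticomplete z'D z'd _ _ dD db bD.
  have x0b := connect_trans x0z (connect1 zb).
  have bb0 : h b b0.
    apply: anticomplete bD _ d0 _ d0D db0 b0D => // d dD.
    by have := none d; rewrite dD h_sym.
  by have := no_triangle zb (anticomplete _ x0z zD zd _ _ d0D db0 b0D); rewrite bb0.
have twin y a : connect h x y -> away x y -> h x a != h y a -> y \in D.
  move=> xy y_away; apply: contraR => yD; apply/eqP.
  have yd d : d \in D -> ~~ h y d.
    move=> dD; apply: contra yD => yd.
    by apply: D_closed dD (D_away _ dD) y_away _; rewrite h_sym.
  by apply/idP/idP; apply: same => //; apply: xC.
exists x => // y z a b xy xz y_away z_away ya zb.
have := twin y a xy y_away ya; have := twin z b xz z_away zb; rewrite !inE /= => cz cy.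
by apply: connect_trans cz; rewrite restrict_connect_sym.
Qed.

(** * Cocomparability orderings *)

Lemma component_key x0 : exists k : V -> nat, forall u v w,
  connect h x0 u -> connect h x0 v -> connect h x0 w ->
  k u <= k v -> k v <= k w -> h u w -> h u v || h v w.
Proof.
have [x x0x away_connected] := extremal_vertex x0.
have [lev [lev_x lev_root lev_adj lev_up]] := levels_exist x.
have [k kE] := lex_key lev (score lev).
exists k => u v w x0u x0v x0w; rewrite !kE.
have xC y : connect h x0 y -> connect h x y.
  by apply: connect_trans; rewrite h_connect_sym.
apply: (@layer_cocomparability x (connect h x)) => //; try exact: xC.
by move=> y z xy yz; exact: connect_trans xy (connect1 yz).
Qed.

(** An umbrella-free ordering: the components follow one another, each sorted by its own key, with
    ties broken by [enum_rank]. Since [u] and [w] lie in one component, so does [v]. *)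
Lemma cocomparability_key : exists2 k : V -> nat, injective k &
  forall u v w, k u < k v -> k v < k w -> h u w -> h u v || h v w.
Proof.
have [K KP] := fin_all_exists component_key.
have [k1 k1E] := lex_key (fun u => enum_rank (fingraph.root h u)) (fun u => K (fingraph.root h u) u).
have [k kE] := lex_key k1 (fun u => enum_rank u).
have k_inj : injective k.
  move=> u v uv; have := kE u v; have := kE v u; rewrite uv leqnn.
  by case: ltngtP => //= _ /esym uv1 /esym vu1;
    apply/enum_rank_inj/val_inj/eqP; rewrite eqn_leq uv1 vu1.
exists k => // u v w uv vw huw.
have mono a b : k a < k b -> k1 a <= k1 b.
  by move/ltnW; rewrite kE => /orP[/ltnW|/andP[/eqP-> _]].
have {uv}uv := mono _ _ uv; have {vw}vw := mono _ _ vw.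
have ruw : fingraph.root h u = fingraph.root h w.
  by apply/eqP; rewrite root_connect ?connect1 //; exact: h_connect_sym.
have [ruv rvw] : fingraph.root h u = fingraph.root h v /\ fingraph.root h v = fingraph.root h w.
  move: uv vw; rewrite !k1E -ruw => uv vw.
  suff : fingraph.root h u = fingraph.root h v by [].
  apply/enum_rank_inj/val_inj/eqP; rewrite /= eqn_leq.
  apply/andP; split; first by case/orP: uv => [/ltnW|/andP[/eqP->]].
  by case/orP: vw => [/ltnW|/andP[/eqP->]].
have conn a : connect h (fingraph.root h a) a by rewrite h_connect_sym connect_root.
move: uv vw; rewrite !k1E ruv rvw !ltnn eqxx /=.
have cu := conn u; have cv := conn v; rewrite ruw in cu; rewrite rvw in cv.
by move=> uv vw; exact: KP cu cv (conn w) uv vw huw.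
Qed.

(** * Merging the ordering with the bipartition *)

Lemma linear_rank (lt : rel V) : irreflexive lt -> transitive lt ->
  (forall u v, u != v -> lt u v || lt v u) ->
  exists2 pos : V -> nat, forall u, pos u < #|V| & forall u v, (pos u < pos v) = lt u v.
Proof.
move=> lt_irr lt_trans lt_total.
have pos_lt u v : lt u v -> #|[set z | lt z u]| < #|[set z | lt z v]|.
  move=> uv; apply: proper_card; apply/properP; split.
    by apply/subsetP => z; rewrite !inE => zu; exact: lt_trans uv.
  by exists u; rewrite inE ?lt_irr.
exists (fun v => #|[set z | lt z v]|) => [u|u v].
  by rewrite -[#|V|]cardsT proper_card //; apply/properP;
    split; [exact: subsetT|exists u]; rewrite inE ?lt_irr.
apply/idP/idP => [uv|/pos_lt //]; have [e|/lt_total/orP[//|/pos_lt]] := eqVneq u v.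
  by rewrite e ltnn in uv.
by rewrite ltnNge ltnW.
Qed.

Section Merge.
Variables (B : {set V}) (k : V -> nat).
Hypothesis B_bip : forall x y, h x y -> (x \in B) != (y \in B).
Hypothesis k_inj : injective k.
Hypothesis k_cocomp : forall u v w, k u < k v -> k v < k w -> h u w -> h u v || h v w.

(** Used with [A] and with its complement as [B]: the two orders agree exactly on the pairs not
    adjacent for [h]. *)
Definition merge_order : rel V := [rel u v | if h u v then u \in B else k u < k v].

Lemma merge_irr : irreflexive merge_order.
Proof. by move=> u; rewrite /merge_order /= bip_irr ltnn. Qed.

Lemma merge_total u v : u != v -> merge_order u v || merge_order v u.
Proof.
rewrite /merge_order /= (h_sym v) => uv; case: ifP => [/B_bip|_].
  by do 2 case: (_ \in B).
by rewrite -neq_ltn (inj_eq k_inj).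
Qed.

(** A failure would put both ends of an edge into [B], or give three vertices increasing for [k]
    whose outer pair is an edge and whose middle vertex sees neither end. *)
Lemma merge_trans : transitive merge_order.
Proof.
move=> v u w; rewrite /merge_order /=.
have no_cycle a b c : k a < k b -> k b < k c -> h a b = false -> h b c = false -> h a c -> False.
  by move=> ab bc nab nbc /(k_cocomp ab bc); rewrite nab nbc.
have wu_lt : h u w = false -> ~~ (k u < k w) -> u != w -> k w < k u.
  by move=> _; rewrite -leqNgt leq_eqVlt => /orP[/eqP/k_inj->|//]; rewrite eqxx.
case: ifP => huv; case: ifP => hvw.
- by move: (B_bip huv) => /[swap] -> /[swap] ->.
- move=> uB vw; case: ifP => // huw; apply/negPn/negP => uw.
  have uNw : u != w by apply: contraFneq hvw => <-; rewrite h_sym.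
  by apply: (no_cycle v w u) => //; rewrite 1?h_sym //; exact: wu_lt.
- move=> uv vB; case: ifP => huw.
    by have := B_bip huw; have := B_bip hvw; rewrite vB; do 2 case: (_ \in B).
  apply/negPn/negP => uw.
  have uNw : u != w by apply: contraFneq huv => ->; rewrite h_sym.
  by apply: (no_cycle w u v) => //; rewrite 1?h_sym //; exact: wu_lt.
- move=> uv vw; case: ifP => huw; last exact: ltn_trans vw.
  by case: (no_cycle u v w).
Qed.

End Merge.

(** Left ends lie below [#|V|] and right ends do not, so two intervals fail to overlap only if one
    lies strictly inside the other, that is, if the two merged orders disagree. *)
Lemma merge_model : exists l r : V -> nat, (forall v, l v < r v) /\
  forall u v, u != v -> ~~ h u v =
    [&& l u <= l v, l v <= r u & r u <= r v] || [&& l v <= l u, l u <= r v & r v <= r u].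
Proof.
have [k k_inj k_cocomp] := cocomparability_key.
have h_bipC x y : h x y -> (x \in ~: A) != (y \in ~: A).
  by move/h_bip; rewrite !inE (inj_eq negb_inj).
have [p pn pE] := linear_rank (merge_irr A k) (merge_trans h_bip k_inj k_cocomp)
  (merge_total h_bip k_inj).
have [q qn qE] := linear_rank (merge_irr (~: A) k) (merge_trans h_bipC k_inj k_cocomp)
  (merge_total h_bipC k_inj).
exists p, (fun v => #|V| + q v); split=> [v|u v uv]; first exact: leq_trans (pn v) (leq_addr _ _).
have pq a b : p a <= #|V| + q b by rewrite (leq_trans (ltnW (pn a))) ?leq_addr.
rewrite !pq !leq_add2l /= !(leqNgt (p _)) !(leqNgt (q _)) !pE !qE /merge_order /= (h_sym v).
case: ifP => huv; last by have := uv; rewrite -(inj_eq k_inj); case: ltngtP.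
by rewrite !inE (side_flip huv); case: (_ \in A).
Qed.

End Bipartite.

Import Order.TTheory GRing.Theory Num.Theory.

(** * Chords as overlapping intervals *)

Section Stereographic.
Local Open Scope ring_scope.
Variable R : realType.
Implicit Types (s t : R) (d : (R * R) * (R * R)).

(** Inverse stereographic projection from [(-1, 0)] onto the unit circle; it turns crossing of
    chords into a condition on the order of real parameters. *)
Definition stereo t : R * R := ((1 - t ^+ 2) / (1 + t ^+ 2), 2 * t / (1 + t ^+ 2)).

Lemma onepsq_gt0 t : 0 < 1 + t ^+ 2.
Proof. by rewrite ltr_wpDr // sqr_ge0. Qed.

Lemma onepsq_neq0 t : 1 + t ^+ 2 != 0.
Proof. by rewrite gt_eqF // onepsq_gt0. Qed.

Lemma chords_meet_sym d d' : chords_meet d d' -> chords_meet d' d.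
Proof. by case=> z [? ?]; exists z. Qed.

Definition affine_map (u v w : R * R) (z : R * R) : R * R :=
  (u.1 * z.1 + v.1 * z.2 + w.1, u.2 * z.1 + v.2 * z.2 + w.2).

Lemma chords_meet_affine u v w (f := affine_map u v w) d d' :
  chords_meet d d' -> chords_meet (f d.1, f d.2) (f d'.1, f d'.2).
Proof.
case=> z [[a a01 za] [b b01 zb]]; exists (f z); split.
- by exists a => //; rewrite za /f /affine_map /=; congr pair; ring.
- by exists b => //; rewrite zb /f /affine_map /=; congr pair; ring.
Qed.

(* An affine form vanishing at [stereo s] and [stereo t]. *)
Definition secant s t (z : R * R) : R :=
  (1 - z.1) - (s + t) * z.2 + s * t * (1 + z.1).

(** The sign at [stereo x] tells whether [x] lies between [s] and [t]. *)
Lemma secant_stereo s t x :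
  secant s t (stereo x) = 2 * ((x - s) * (x - t)) / (1 + x ^+ 2).
Proof. by rewrite /secant /stereo /=; field; exact: onepsq_neq0. Qed.

Lemma secant_segment s t p q z (a : R) :
  z = ((1 - a) * p.1 + a * q.1, (1 - a) * p.2 + a * q.2) ->
  secant s t z = (1 - a) * secant s t p + a * secant s t q.
Proof. by move=> ->; rewrite /secant /=; ring. Qed.

Definition overlap s t s' t' := [&& s <= s', s' <= t & t <= t'].

Lemma secant_gt0 s t x :
  (0 < secant s t (stereo x)) = (0 < (x - s) * (x - t)).
Proof.
by rewrite secant_stereo -mulrA pmulr_rgt0 // pmulr_lgt0 // invr_gt0 onepsq_gt0.
Qed.

Lemma secant_lt0 s t x :
  (secant s t (stereo x) < 0) = ((x - s) * (x - t) < 0).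
Proof.
by rewrite secant_stereo -mulrA pmulr_rlt0 // pmulr_llt0 // invr_gt0 onepsq_gt0.
Qed.

(** The secant of the first chord vanishes at the common point, a convex combination of the ends of
    the second chord. So these ends are not strictly on the same side. *)
Lemma meet_overlap s t s' t' : s < t -> s' < t' ->
  chords_meet (stereo s, stereo t) (stereo s', stereo t') ->
  overlap s t s' t' || overlap s' t' s t.
Proof.
move=> st st' [z [[a /andP[a0 a1] /(@secant_segment s t) za]
   [b /andP[b0 b1] /(@secant_segment s t) zb]]].
apply/negPn/negP; rewrite /overlap => noover.
have {}za : secant s t z = 0.
  by rewrite za !secant_stereo /= !subrr !(mulr0, mul0r) addr0.
have pos p q : 0 < p -> 0 < q -> 0 < (1 - b) * p + b * q.
  move=> p0 q0; have [->|b1'] := eqVneq b 1; first by rewrite subrr mul0r add0r mul1r.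
  by apply: ltr_pwDl; [rewrite mulr_gt0 // subr_gt0 lt_neqAle b1'|rewrite mulr_ge0 // ltW].
have [/andP[h1 h2]|h] := boolP ((0 < (s' - s) * (s' - t)) && (0 < (t' - s) * (t' - t))).
  rewrite -!secant_gt0 in h1 h2.
  by have := pos _ _ h1 h2; rewrite -zb za ltxx.
have [/andP[h1 h2]|h'] := boolP (((s' - s) * (s' - t) < 0) && ((t' - s) * (t' - t) < 0)).
  have k1 : 0 < - secant s t (stereo s') by rewrite oppr_gt0 secant_lt0.
  have k2 : 0 < - secant s t (stereo t') by rewrite oppr_gt0 secant_lt0.
  by have := pos _ _ k1 k2; rewrite !mulrN -opprD -zb za oppr0 ltxx.
case/negP: noover; have [ss|ss] := ltP s' s.
  have pos1 : 0 < (s' - s) * (s' - t) by rewrite nmulr_rgt0 subr_lt0; lra.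
  apply/orP; right; rewrite (ltW ss) /=; apply: contraR h; rewrite negb_and -!ltNge pos1 /=.
  by case/orP=> h; [rewrite nmulr_rgt0 subr_lt0; lra|rewrite mulr_gt0 ?subr_gt0; lra].
have [st1|st1] := leP s' t => /=; last first.
  by case/negP: h; rewrite !mulr_gt0 ?subr_gt0; lra.
have [//|tt] := leP t t' => /=; have [ss'|ss'] := leP s' s.
  by rewrite (ltW tt) andbT; lra.
by case/negP: h'; rewrite !pmulr_rlt0 ?subr_lt0 ?subr_gt0; lra.
Qed.

Lemma overlap_meet s t s' t' : s < t -> s' < t' -> overlap s t s' t' ->
  chords_meet (stereo s, stereo t) (stereo s', stereo t').
Proof.
move=> st st' /and3P[ss' s't tt'].
have seg0 (p q : R * R) : on_segment p q p.
  by exists 0; rewrite ?lexx ?ler01 // subr0 !mul1r !mul0r !addr0 -surjective_pairing.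
have seg1 (p q : R * R) : on_segment p q q.
  by exists 1; rewrite ?lexx ?ler01 // subrr !mul1r !mul0r !add0r -surjective_pairing.
have [<-|ss] := eqVneq s s'; first by exists (stereo s); split; apply: seg0.
have [<-|s't0] := eqVneq s' t; first by exists (stereo s'); split; [apply: seg1|apply: seg0].
have [<-|tt0] := eqVneq t t'; first by exists (stereo t); split; apply: seg1.
have {ss ss'}ss : 0 < s' - s by rewrite subr_gt0 lt_neqAle ss.
have {s't s't0}s't : 0 < t - s' by rewrite subr_gt0 lt_neqAle s't0.
have {tt0 tt'}tt : 0 < t' - t by rewrite subr_gt0 lt_neqAle tt0.
have ss2 : 0 < t' - s by lra.
have P1 := onepsq_gt0 s; have P2 := onepsq_gt0 t.
have P3 := onepsq_gt0 s'; have P4 := onepsq_gt0 t'.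
(* [A / (A + B)] and [C / (C + D)] place the crossing point on the second and on the first chord.
   They come from the values of each chord's secant at the ends of the other, with denominators
   cleared. *)
pose A := (s' - s) * (t - s') * (1 + t' ^+ 2).
pose B := (t' - s) * (t' - t) * (1 + s' ^+ 2).
pose C := (s' - s) * (t' - s) * (1 + t ^+ 2).
pose D := (t - s') * (t' - t) * (1 + s ^+ 2).
have [A0 B0 C0 D0] : [/\ 0 < A, 0 < B, 0 < C & 0 < D].
  by split; rewrite !mulr_gt0.
have w01 (a b : R) : 0 < a -> 0 < b -> 0 <= a / (a + b) <= 1.
  move=> a0 b0; have ab0 : 0 < a + b := addr_gt0 a0 b0; apply/andP; split.
    by apply: divr_ge0; apply: ltW.
  by rewrite ler_pdivrMr // mul1r lerDl ltW.
exists ((1 - C / (C + D)) * (stereo s).1 + C / (C + D) * (stereo t).1,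
   (1 - C / (C + D)) * (stereo s).2 + C / (C + D) * (stereo t).2); split.
  by exists (C / (C + D)) => //; exact: w01.
exists (A / (A + B)); first exact: w01.
have AB0 : A + B != 0 by rewrite gt_eqF ?addr_gt0.
have CD0 : C + D != 0 by rewrite gt_eqF ?addr_gt0.
by rewrite /stereo /=; congr pair; move: AB0 CD0; rewrite /A /B /C /D => AB0 CD0;
  field; rewrite ?onepsq_neq0 ?AB0 ?CD0.
Qed.

End Stereographic.

(** * Circle graphs as overlap graphs of intervals *)

Section CircleModel.
Local Open Scope ring_scope.
Variable R : realType.
Implicit Types (s t : R) (d : (R * R) * (R * R)).

Lemma stereo_unit t : (stereo t).1 ^+ 2 + (stereo t).2 ^+ 2 = 1.
Proof. by rewrite /stereo /=; field; exact: onepsq_neq0. Qed.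

Lemma stereo_inj : injective (@stereo R).
Proof.
move=> s t [e1 e2].
have two0 : 2 != 0 :> R by rewrite pnatr_eq0.
have r1 (x : R) : (1 - x ^+ 2) / (1 + x ^+ 2) = 2 / (1 + x ^+ 2) - 1.
  by field; exact: onepsq_neq0.
have {e1}e : 1 + s ^+ 2 = 1 + t ^+ 2.
  by move: e1; rewrite !r1 => /addIr /(mulfI two0) /invr_inj.
move: e2; rewrite e => /(mulIf (invr_neq0 (onepsq_neq0 t))).
exact: mulfI.
Qed.

Lemma stereo_onto (e : R * R) : e.1 ^+ 2 + e.2 ^+ 2 = 1 -> e != (-1, 0) ->
  e = stereo (e.2 / (1 + e.1)).
Proof.
case: e => x y /= xy ne.
have x1 : 1 + x != 0.
  apply: contra ne => /eqP x1; have {}x1 : x = - 1 by lra.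
  by move: xy; rewrite x1 sqrrN expr1n => /eqP; rewrite -subr_eq0 addrC addKr sqrf_eq0 => /eqP->.
have y2 : y ^+ 2 = (1 - x) * (1 + x) by rewrite -[LHS](addKr (x ^+ 2)) xy; ring.
have den : 1 + (y / (1 + x)) ^+ 2 = 2 / (1 + x).
  by rewrite expr_div_n y2; field.
by rewrite /stereo den expr_div_n y2; congr pair; field.
Qed.

Lemma chords_meet_flip p q d : chords_meet (p, q) d -> chords_meet (q, p) d.
Proof.
case=> z [[a /andP[a0 a1] ->] zd]; eexists; split; last exact: zd.
exists (1 - a); first by rewrite subr_ge0 a1 gerBl.
by congr pair => /=; ring.
Qed.

Definition overlap_model (G : sgraph) (l r : G -> R) : Prop :=
  (forall v, l v < r v) /\
  forall u v, u != v ->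
    u -- v = overlap (l u) (r u) (l v) (r v) || overlap (l v) (r v) (l u) (r u).

Lemma overlap_circle_graph (G : sgraph) l r : @overlap_model G l r -> circle_graph R G.
Proof.
case=> lr adj; exists (0, 0), 1, (fun v => (stereo (l v), stereo (r v))); split=> // [v|u v uv].
  split; rewrite /on_circle /= ?subr0 ?expr1n ?stereo_unit //.
  by rewrite (inj_eq stereo_inj) lt_eqF.
rewrite adj //; split=> [/orP[ov|ov]|]; last exact: meet_overlap.
  exact: overlap_meet.
by apply/chords_meet_sym/overlap_meet.
Qed.

(** Cut the circle at a point that is no end of a chord, and read the chords as intervals of
    stereographic parameters. *)
Lemma circle_graph_overlap (G : sgraph) :
  circle_graph R G -> exists l r, @overlap_model G l r.
Proof.
case=> [[c1 c2]] [rho [chord [rho0 chordP adj]]].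
have rhoN0 : rho != 0 by rewrite gt_eqF.
have [n n1 nP] : exists2 n : R * R, n.1 ^+ 2 + n.2 ^+ 2 = 1 &
    forall v, (chord v).1 != (c1 + rho * n.1, c2 + rho * n.2) /\
              (chord v).2 != (c1 + rho * n.1, c2 + rho * n.2).
  pose ends := [seq (chord v).1 | v <- enum G] ++ [seq (chord v).2 | v <- enum G].
  pose pt (k : nat) := (c1 + rho * (stereo k%:R).1, c2 + rho * (stereo k%:R).2).
  have pt_inj : injective pt.
    move=> j k ejk; have e1 : c1 + rho * (stereo j%:R).1 = c1 + rho * (stereo k%:R).1.
      exact: (congr1 fst ejk).
    have e2 : c2 + rho * (stereo j%:R).2 = c2 + rho * (stereo k%:R).2.
      exact: (congr1 snd ejk).
    move: e1 e2 => /addrI/(mulfI rhoN0) e1 /addrI/(mulfI rhoN0) e2.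
    apply: (mulrIn (oner_neq0 R)); apply: stereo_inj.
    by rewrite [LHS]surjective_pairing [RHS]surjective_pairing e1 e2.
  (* Pigeonhole: one more distinct point of the circle than there are chord ends. *)
  have [/allP all_ends|/allPn[p /mapP[k _ ->] pt_ends]] :=
      boolP (all (mem ends) [seq pt k | k <- iota 0 (size ends).+1]).
    have := uniq_leq_size _ all_ends.
    by rewrite map_inj_uniq // iota_uniq size_map size_iota ltnn => /(_ isT).
  exists (stereo k%:R) => [|v]; first exact: stereo_unit.
  by split; apply: contraNneq pt_ends => e; rewrite /pt -e /= /ends mem_cat;
    apply/orP; [left|right]; apply: map_f; rewrite mem_enum.
(* [F'] is the similarity onto the unit circle that sends the cutting point to [(-1, 0)], the point
   missed by [stereo]; [F] is its inverse. *)
pose F := affine_map (- rho * n.1, - rho * n.2) (rho * n.2, - rho * n.1) (c1, c2).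
pose F' := affine_map (- n.1 / rho, n.2 / rho) (- n.2 / rho, - n.1 / rho)
  ((c1 * n.1 + c2 * n.2) / rho, (c2 * n.1 - c1 * n.2) / rho).
have FK p : F (F' p) = p.
  suff -> : F (F' p) = (p.1 * (n.1 ^+ 2 + n.2 ^+ 2) + c1 * (1 - (n.1 ^+ 2 + n.2 ^+ 2)),
      p.2 * (n.1 ^+ 2 + n.2 ^+ 2) + c2 * (1 - (n.1 ^+ 2 + n.2 ^+ 2))).
    by rewrite n1 subrr !mulr0 !mulr1 !addr0 -surjective_pairing.
  by rewrite /F /F' /affine_map /=; congr pair; field.
pose tt p := (F' p).2 / (1 + (F' p).1).
have ttP p : on_circle (c1, c2) rho p -> p != (c1 + rho * n.1, c2 + rho * n.2) ->
    F' p = stereo (tt p).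
  rewrite /on_circle /= => pc pn; apply: stereo_onto.
    rewrite /F' /affine_map /=; apply: (mulIf (expf_neq0 2 rhoN0)).
    transitivity (((p.1 - c1) ^+ 2 + (p.2 - c2) ^+ 2) * (n.1 ^+ 2 + n.2 ^+ 2)).
      by field.
    by rewrite n1 pc mulr1 mul1r.
  apply: contra pn => /eqP pn; rewrite -[p]FK pn /F /affine_map /=.
  by apply/eqP; congr pair; ring.
pose t1 v := tt (chord v).1; pose t2 v := tt (chord v).2.
have e1 v : F' (chord v).1 = stereo (t1 v).
  by have [? _ _] := chordP v; have [? _] := nP v; exact: ttP.
have e2 v : F' (chord v).2 = stereo (t2 v).
  by have [_ ? _] := chordP v; have [_ ?] := nP v; exact: ttP.
have t12 v : t1 v != t2 v.
  have [_ _] := chordP v; apply: contraNneq => t12.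
  by rewrite -[(chord v).1]FK -[(chord v).2]FK e1 e2 t12.
exists (fun v => Num.min (t1 v) (t2 v)), (fun v => Num.max (t1 v) (t2 v)).
have minmax v : (t1 v < t2 v /\ (Num.min (t1 v) (t2 v), Num.max (t1 v) (t2 v)) = (t1 v, t2 v))
    \/ (t2 v < t1 v /\ (Num.min (t1 v) (t2 v), Num.max (t1 v) (t2 v)) = (t2 v, t1 v)).
  by have /orP[lt|lt] := lt_total (t12 v); [left|right]; split=> //;
    [rewrite min_l ?max_r ?ltW | rewrite min_r ?max_l ?ltW].
have lr v : Num.min (t1 v) (t2 v) < Num.max (t1 v) (t2 v).
  by case: (minmax v) => -[lt [-> ->]].
split=> // u v uv; apply/idP/idP.
  move/(adj _ _ uv)/(chords_meet_affine (- n.1 / rho, n.2 / rho) (- n.2 / rho, - n.1 / rho)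
  ((c1 * n.1 + c2 * n.2) / rho, (c2 * n.1 - c1 * n.2) / rho)).
  rewrite -/F' !e1 !e2 => meet; apply: meet_overlap => //.
  have flip d w : chords_meet (stereo (t1 w), stereo (t2 w)) d ->
    chords_meet (stereo (Num.min (t1 w) (t2 w)), stereo (Num.max (t1 w) (t2 w))) d.
    by case: (minmax w) => -[_ [-> ->]] // /chords_meet_flip.
  by apply/flip/chords_meet_sym/flip/chords_meet_sym.
have flip d w :
    chords_meet (stereo (Num.min (t1 w) (t2 w)), stereo (Num.max (t1 w) (t2 w))) d ->
    chords_meet (F' (chord w).1, F' (chord w).2) d.
  by rewrite e1 e2; case: (minmax w) => -[_ [-> ->]] // /chords_meet_flip.
move=> ov; apply/(adj _ _ uv).
have {ov} meet : chords_meet (F' (chord u).1, F' (chord u).2) (F' (chord v).1, F' (chord v).2).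
  apply/flip/chords_meet_sym/flip; case/orP: ov => ov; last exact: overlap_meet.
  by apply/chords_meet_sym/overlap_meet.
move/(chords_meet_affine (- rho * n.1, - rho * n.2) (rho * n.2, - rho * n.1) (c1, c2)): meet.
by rewrite -/F !FK -!surjective_pairing.
Qed.

End CircleModel.

(** * The forbidden graphs are not circle graphs *)

Lemma contains_inducedE (G H : sgraph) : contains_induced G H <->
  exists2 f : H -> G, injective f & forall x y, (f x -- f y) = (x -- y).
Proof.
split=> [[S [f [g fK gK] fE]]|[f f_inj fE]].
  exists (fun x => val (g x)) => [x y /val_inj/(can_inj gK)//|x y].
  by rewrite -[in RHS](gK x) -[in RHS](gK y) fE.
have fin x : f x \in f @: [set: H] by rewrite imset_f ?inE.
pose f' x : induced (f @: [set: H]) := exist _ (f x) (fin x).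
have f'_inj : injective f' by move=> x y /(congr1 val)/f_inj.
have [|g f'K gK] := inj_card_bij f'_inj.
  by rewrite card_sig (eq_card (B := mem (f @: [set: H]))) ?card_imset ?cardsT // => x; rewrite inE.
exists (f @: [set: H]), g; first by exists f'.
by move=> x y; rewrite -[in RHS](gK x) -[in RHS](gK y) /= -fE.
Qed.

(** A step replaces one end of an edge by a non-neighbor of that end; in an overlap model it
    reverses [orient]. *)
Definition forces (H : sgraph) : rel (H * H) :=
  [rel a b | [&& a.2 == b.2, compl_edge a.1 b.1, a.1 -- a.2 & b.1 -- b.2]
          || [&& a.1 == b.1, compl_edge a.2 b.2, a.1 -- a.2 & b.1 -- b.2]].

Notation v7 i := (@Ordinal 7 i isT).

Section Forcing.
Variables (R : realType) (G : sgraph) (l r : G -> R).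
Hypotheses (model : overlap_model l r) (cobip : cobipartite G).
Local Notation h := (@compl_edge G).

Definition meets u v := overlap (l u) (r u) (l v) (r v) || overlap (l v) (r v) (l u) (r u).

Definition nbrs_inside (x : G) : bool :=
  [exists y, [&& h x y, (l x < l y)%R & (r y < r x)%R]].

Definition orient (x z : G) : bool :=
  (l x + r x < l z + r z)%R (+) nbrs_inside x (+) nbrs_inside z.

Lemma compl_no_triangle x y z : h x y -> h x z -> h y z = false.
Proof.
have [A bip] := cobip; move=> /bip xy /bip xz; apply/negP => /bip.
by move: xy xz; do 3 case: (_ \in A).
Qed.

Lemma adj_neq (x y : G) : x -- y -> x != y.
Proof. by apply: contraTneq => ->; rewrite sedge_irr. Qed.

(** One neighbor speaks for all: two neighbors of [x] for [h] are adjacent in [G], so their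
    intervals meet, which is impossible if exactly one of them lies inside that of [x]. *)
Lemma nbrs_insideE x y : h x y -> nbrs_inside x = (l x < l y)%R && (r y < r x)%R.
Proof.
have [lr adj] := model; move=> xy; apply/existsP/idP => [[y' /and3P[xy' ll rr]]|/andP[ll rr]].
  have := compl_no_triangle xy xy'; rewrite /compl_edge /=.
  have [->|yy' /negbFE] := eqVneq y y'; first by rewrite ll rr.
  rewrite (adj _ _ yy'); move: xy => /andP[xy]; rewrite (adj _ _ xy) /overlap.
  have := (lr x, lr y, lr y'); move: ll rr; case=> [[]]; lra.
by exists y; rewrite xy ll rr.
Qed.

(** The intervals of [x] and [y] are disjoint or nested. If disjoint, the midpoint of [z] lies
    between theirs and neither correction is set; if nested, it lies on the same side of both and
    exactly one correction is set. *)
Lemma orient_forcing x y z : h x y -> x -- z -> y -- z ->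
  orient z x = ~~ orient x z /\ orient y z = ~~ orient x z.
Proof.
have [lr adj] := model; move=> xy xz yz.
have yx : h y x by rewrite compl_edge_sym.
rewrite /orient (nbrs_insideE xy) (nbrs_insideE yx).
case/andP: xy => xy; rewrite (adj _ _ xy).
have := adj_neq xz; have := adj_neq yz.
move: xz yz; move=> xz yz nyz nxz; rewrite (adj _ _ nxz) in xz; rewrite (adj _ _ nyz) in yz.
move: (nbrs_inside z) xz yz {nyz nxz xy yx} => b xz yz noxy.
have apart p q : (r p < l q)%R -> meets p z -> meets q z ->
    (l p + r p < l z + r z)%R /\ (l z + r z < l q + r q)%R.
  move: (lr p) (lr q) (lr z) => lp lq lz pq.
  by move=> /orP[] /and3P[? ? ?] /orP[] /and3P[? ? ?]; split; lra.
have nested p q : (l p < l q)%R -> (r q < r p)%R -> meets p z -> meets q z ->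
    (l p + r p < l z + r z)%R /\ (l q + r q < l z + r z)%R \/
    (l z + r z < l p + r p)%R /\ (l z + r z < l q + r q)%R.
  move: (lr p) (lr q) (lr z) => lp lq lz pq1 pq2 /orP[] /and3P[? ? ?] /orP[] /and3P[? ? ?];
   by [left; split; lra | right; split; lra | exfalso; lra].
have {noxy} : [\/ r x < l y, r y < l x, (l x < l y) && (r y < r x) | (l y < l x) && (r x < r y)]%R.
  move: noxy; rewrite /overlap negb_or !negb_and -!ltNge => noxy.
  have [a1|a1] := ltP (r x) (l y); first exact: Or41.
  have [a2|a2] := ltP (r y) (l x); first exact: Or42.
  have [a3|a3] := ltP (l x) (l y); [apply: Or43|apply: Or44].
    by apply/andP; split; move: a1 a2 a3 noxy; lra.
  by apply/andP; split; move: a1 a2 a3 noxy; lra.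
have [[lx ly] lz] := (lr x, lr y, lr z).
case=> [c|c|/andP[c1 c2]|/andP[c1 c2]].
- have [s1 s2] := apart _ _ c xz yz.
  have e1 : (r x < r y)%R by lra.
  have e2 : (l x < l y)%R by lra.
  by rewrite (lt_gtF s1) (lt_gtF s2) s1 (lt_gtF e1) (lt_gtF e2) andbF /=; case: b.
- have [s1 s2] := apart _ _ c yz xz.
  have e1 : (r y < r x)%R by lra.
  have e2 : (l y < l x)%R by lra.
  by rewrite (lt_gtF s2) s1 s2 (lt_gtF e1) (lt_gtF e2) andbF /=; case: b.
- by have [[s1 s2]|[s1 s2]] := nested _ _ c1 c2 xz yz; rewrite c1 c2 (lt_gtF c1);
    rewrite (lt_gtF s1) ?(lt_gtF s2) s1 ?s2 /=; case: b.
- by have [[s1 s2]|[s1 s2]] := nested _ _ c1 c2 yz xz; rewrite c1 c2 (lt_gtF c1);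
    rewrite (lt_gtF s2) ?(lt_gtF s1) s2 ?s1 /=; case: b.
Qed.

Lemma orient_anti x y z : h x y -> x -- z -> y -- z -> orient z x = ~~ orient x z.
Proof. by move=> xy xz yz; case: (orient_forcing xy xz yz). Qed.

Lemma orient_stepl x y z : h x y -> x -- z -> y -- z -> orient y z = ~~ orient x z.
Proof. by move=> xy xz yz; case: (orient_forcing xy xz yz). Qed.

Lemma orient_stepr x y z : h x y -> z -- x -> z -- y -> orient z y = ~~ orient z x.
Proof.
rewrite ![z -- _]sedge_sym => xy xz yz; have yx : h y x by rewrite compl_edge_sym.
by rewrite (orient_anti xy) // (orient_anti yx) // (orient_stepl xy).
Qed.

(** Every step flips [orient], so this walk of even length gives [(x, z)] and [(z, x)] the same
    value, against [orient_anti]. *)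
Lemma forcing_odd (H : sgraph) (x z : H) p s :
  path (@forces H) (x, z) (p :: s) -> last p s = (z, x) -> odd (size s) ->
  ~ contains_induced G H.
Proof.
move=> pth plast s_odd /contains_inducedE[f f_inj fE].
pose o (p : H * H) := orient (f p.1) (f p.2).
have fh a b : compl_edge a b -> h (f a) (f b).
  by rewrite /compl_edge /= (inj_eq f_inj) fE.
have step a b : forces a b -> o b = ~~ o a.
  case: a b => [a1 a2] [b1 b2] /orP[] /and4P[] /= /eqP<- /fh; rewrite -!fE => *.
    by rewrite /o /=; apply: orient_stepl.
  by rewrite /o /=; apply: orient_stepr.
have anti : o (z, x) = ~~ o (x, z).
  case/andP: pth => /orP[] /and4P[] /= /eqP e /fh xy; rewrite -!fE -e => xz yz _.
    exact: orient_anti xy xz yz.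
  by rewrite /o /= (orient_anti xy) ?negbK // sedge_sym.
suff : o (last (x, z) (p :: s)) = odd (size (p :: s)) (+) o (x, z).
  by rewrite /= plast s_odd anti; case: (o _).
elim: (p :: s) (x, z) pth => [|b t IH] a //= /andP[/step ab /IH->].
by rewrite ab; case: (odd _); case: (o a).
Qed.

(** For each of the three graphs, an explicit walk from labels 1, 2 to 2, 1 is checked by
    computation; [v7 i] has label [i + 1]. *)
Lemma G1_not_induced : ~ contains_induced G G1.
Proof.
exact: (@forcing_odd G1 (v7 0) (v7 1) (v7 0, v7 3) [:: (v7 6, v7 3); (v7 2, v7 3);
  (v7 2, v7 1); (v7 2, v7 5); (v7 2, v7 0); (v7 2, v7 4); (v7 6, v7 4); (v7 1, v7 4); (v7 1, v7 0)]).
Qed.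

Lemma G2_not_induced : ~ contains_induced G G2.
Proof.
exact: (@forcing_odd G2 (v7 0) (v7 1) (v7 3, v7 1) [:: (v7 3, v7 6); (v7 3, v7 2); (v7 0, v7 2);
  (v7 5, v7 2); (v7 1, v7 2); (v7 1, v7 4); (v7 1, v7 0)]).
Qed.

Lemma G3_not_induced : ~ contains_induced G G3.
Proof.
exact: (@forcing_odd G3 (v7 0) (v7 1) (v7 3, v7 1) [:: (v7 3, v7 6); (v7 3, v7 2); (v7 0, v7 2);
  (v7 0, v7 4); (v7 6, v7 4); (v7 1, v7 4); (v7 1, v7 2); (v7 5, v7 2); (v7 5, v7 6);
  (v7 5, v7 0); (v7 1, v7 0)]).
Qed.

(** Shifting a pair at distance 2 along the cycle takes two steps and preserves [orient], so
    [(g (2k-2), g 0)] agrees with [(g 0, g 2)]. Moving the second end of the latter to [g (2k-2)]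
    takes [2k-4] steps, again an even number, so [(g 0, g (2k-2))] agrees as well. *)
Lemma cocycle_not_induced k : 3 <= k -> ~ contains_induced G (compl (cycle_graph (2 * k))).
Proof.
move=> k3 /contains_inducedE[f f_inj fE].
have n0 : 0 < 2 * k by lia.
have modD m a b : a < 2 * k -> b < 2 * k -> (m + a == m + b %[mod 2 * k]) = (a == b).
  by move=> ak bk; rewrite eqn_modDl !modn_small.
pose g m := f (Ordinal (ltn_pmod m n0)).
have ordS_mod m : ordS (Ordinal (ltn_pmod m n0)) = Ordinal (ltn_pmod m.+1 n0).
  by apply: val_inj; rewrite /= -addn1 modnDml addn1.
have gh m : h (g m) (g m.+1).
  have ne : (Ordinal (ltn_pmod m n0) != Ordinal (ltn_pmod m.+1 n0)).
    by rewrite -val_eqE /=; have := modD m 0 1; rewrite addn0 addn1 => ->; lia.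
  by rewrite /compl_edge /= (inj_eq f_inj) ne fE /= /compl_edge /= /cycle_edge /= ordS_mod eqxx ne.
have gg m d : 2 <= d <= 2 * k - 2 -> g m -- g (m + d).
  move=> dk; rewrite /g fE /= /compl_edge /= /cycle_edge /= !ordS_mod -!val_eqE /=.
  have [d1 [d2 d3]] : d < 2 * k /\ 1 < 2 * k /\ d.+1 < 2 * k by lia.
  have := modD m 0 d n0 d1; have := modD m 1 d d2 d1; have := modD m d.+1 0 d3 n0.
  rewrite addn0 addn1 addnS => -> -> ->.
  by case: d dk {d1 d3} => [|[|d]].
have gn m : g (m + 2 * k) = g m.
  by rewrite /g; congr f; apply: val_inj; rewrite /= modnDr.
have gsub m d e : e = m + d -> 2 <= d <= 2 * k - 2 -> g m -- g e by move=> -> /gg.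
have shift m : orient (g m.+1) (g m.+3) = orient (g m) (g m.+2).
  rewrite (@orient_stepl (g m) (g m.+1)) //; last 2 first.
  - by apply: (@gsub _ 3); lia.
  - by apply: (@gsub _ 2); lia.
  rewrite (@orient_stepr (g m.+2) (g m.+3)) ?negbK //.
  - by apply: (@gsub _ 2); lia.
  - by apply: (@gsub _ 3); lia.
have all_eq m : orient (g m) (g m.+2) = orient (g 0) (g 2).
  by elim: m => // m <-.
have far d : d <= 2 * k - 4 -> orient (g 0) (g (2 + d)) = odd d (+) orient (g 0) (g 2).
  elim: d => [|d IH] dk; first by rewrite addn0.
  have step : orient (g 0) (g (2 + d).+1) = ~~ orient (g 0) (g (2 + d)).
    by apply: orient_stepr => //; [apply: (@gsub _ (2 + d))|apply: (@gsub _ (2 + d).+1)]; lia.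
  by rewrite addnS step IH ?(ltnW dk) //=; case: (odd d); case: (orient _ _).
have := all_eq (2 * k - 2).
have -> : (2 * k - 2).+2 = 0 + 2 * k by lia.
have -> : 2 * k - 2 = 2 + (2 * k - 4) by lia.
rewrite gn (@orient_anti (g 0) (g 1)) //; last 2 first.
- by apply: (@gsub _ (2 * k - 2)); lia.
- by apply: (@gsub _ (2 * k - 3)); lia.
by rewrite far // (_ : odd _ = false); [case: (orient _ _)|lia].
Qed.

End Forcing.

(** * Patterns and holes as induced subgraphs *)

Section Embeddings.
Variables (G : sgraph) (A : {set G}).
Local Notation h := (@compl_edge G).
Hypothesis h_bip : forall x y : G, h x y -> (x \in A) != (y \in A).

Lemma adjE (x y : G) : x -- y = (x != y) && ~~ h x y.
Proof. by rewrite /compl_edge /=; case: eqVneq => [->|_]; rewrite ?sedge_irr ?negbK. Qed.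

Lemma hole_even n f : 5 <= n -> is_hole h n f -> ~~ odd n.
Proof.
move=> n5 hole.
have alt i : i < n -> (f i \in A) = (f 0 \in A) (+) odd i.
  elim: i => [|i IH] i_n; first by rewrite addbF.
  rewrite (@side_flip _ h A h_bip (f i)) ?IH 1?ltnW ?hole ?eqxx ?ltnSn //=.
  by case: (_ \in A); case: (odd i).
have /h_bip : h (f 0) (f n.-1).
  by rewrite hole; [rewrite !eqxx orbT|case: n n5 {hole alt} => [|[|n]] //= _; rewrite ltnSn].
rewrite (alt n.-1); last by case: n n5 {hole alt} => //= n _; exact: ltnSn.
case: n n5 {hole alt} => // n _ /=; rewrite negbK.
by case: (f 0 \in A); case: (odd n).
Qed.

Lemma hole_induced n f : 5 <= n -> is_hole h n f ->
  contains_induced G (compl (cycle_graph n)).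
Proof.
move=> n5 hole; apply/contains_inducedE.
(* Equal vertices would have the same neighbors on the cycle, which fails for different indices once
   [n >= 5]. *)
have hole_neq i j : i < j < n -> f i != f j.
  move=> ij; apply/eqP => e.
  have [jn|jn] := ltnP j.+1 n.
    have : h (f i) (f j.+1) by rewrite e hole ?eqxx // ltnSn.
    rewrite hole; last by move: ij jn; clear; lia.
    case/orP=> [|/andP[/eqP i0 /eqP jE]]; first by case/andP: ij; clear; lia.
    have : h (f 1) (f j) by rewrite -e i0 compl_edge_sym hole //; exact: leq_trans n5.
    by rewrite hole; move: ij jE jn n5; rewrite i0; clear; lia.
  have ej : j = n.-1 by case/andP: ij jn; clear; lia.
  have : h (f n.-2) (f i) by rewrite e ej hole //; move: n5; clear; lia.
  have [i2|i2] := eqVneq i n.-2; first by rewrite i2 compl_edge_irr.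
  rewrite compl_edge_sym hole; last by move: ij i2 n5; rewrite ej; clear; lia.
  have : h (f 0) (f i) by rewrite e ej hole; move: n5; clear; lia.
  case: (posnP i) => [->|i0]; first by rewrite compl_edge_irr.
  rewrite hole; last by move: ij i0; clear; lia.
  by move: ij i2 n5; rewrite ej; clear; lia.
exists (fun i : 'I_n => f i) => [i j e|i j].
  apply/val_inj; case: (ltngtP i j) => // ij.
    by have := hole_neq i j; rewrite e eqxx ij ltn_ord => /(_ isT).
  by have := hole_neq j i; rewrite e eqxx ij ltn_ord => /(_ isT).
rewrite adjE (_ : i -- j = (i != j) && ~~ cycle_edge i j) //.
wlog ij : i j / i < j => [wl|].
  case: (ltngtP i j) => [|ji|/val_inj->]; [exact: wl| |by rewrite !eqxx].
  by have := wl j i ji; rewrite eq_sym [j == i]eq_sym compl_edge_sym cycle_edge_sym.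
have ne : i != j by rewrite -val_eqE ltn_eqF.
have fne : f i != f j by apply: hole_neq; rewrite ij ltn_ord.
have hij : h (f i) (f j) = (j == i.+1 :> nat) || (i == 0 :> nat) && (j == n.-1 :> nat).
  by apply: hole; rewrite ij ltn_ord.
rewrite hij /cycle_edge /= fne ne /= -!val_eqE /=.
have jn := ltn_ord j.
rewrite modn_small; last by lia.
have [jn1|jn1] := ltnP j.+1 n; first by rewrite modn_small //; congr (~~ _); lia.
have -> : j.+1 = n by lia.
by rewrite modnn; congr (~~ _); lia.
Qed.

Lemma clique34_induced E (s t : seq G) x0 (st := s ++ t) : size s = 3 -> size t = 4 ->
  uniq s -> uniq t -> (forall x y, x \in s -> y \in t -> (x \in A) != (y \in A)) ->
  all (fun e => (e.1 <= 3) && (3 < e.2)) E ->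
  (forall i j, i < 3 <= j -> j < 7 -> h (nth x0 st i) (nth x0 st j) = ((i.+1, j.+1) \notin E)) ->
  contains_induced G (clique34 E).
Proof.
move=> s3 t4 s_uniq t_uniq colors E_bip cross.
have st7 : size st = 7 by rewrite size_cat s3 t4.
have st_uniq : uniq st.
  rewrite cat_uniq s_uniq t_uniq andbT; apply/hasPn => y yt; apply/negP => ys.
  by have := colors y y ys yt; rewrite eqxx.
have [x [xs [y yt]]] : exists x, x \in s /\ exists y, y \in t.
  case: s t s3 t4 {s_uniq t_uniq colors cross st7 st_uniq} @st => [|x s] [|y t] //= _ _.
  by exists x; rewrite mem_head; split=> //; exists y; rewrite mem_head.
have sideE i : i < 7 -> (nth x0 st i \in A) = (y \in A) (+) (i < 3).
  move=> i7; rewrite nth_cat s3; case: ltnP => i3.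
    have := colors (nth x0 s i) y; rewrite mem_nth ?s3 // => /(_ isT yt).
    by do 2 case: (_ \in A).
  have ti : nth x0 t (i - 3) \in t by rewrite mem_nth ?t4 // ltn_subLR.
  have := colors _ _ xs ti; have := colors _ _ xs yt.
  by do 3 case: (_ \in A).
have Erev i j : i < 3 <= j -> (j.+1, i.+1) \notin E.
  by case/andP=> i3 j3; apply/negP => /(allP E_bip) /=; rewrite leqNgt ltnS j3.
apply/contains_inducedE; exists (fun i : 'I_7 => nth x0 st i).
  by move=> i j /eqP; rewrite nth_uniq ?st7 // => /eqP/val_inj.
move=> i j; rewrite adjE nth_uniq ?st7 //.
rewrite [RHS](_ : _ = (i != j) && [|| (i < 3) == (j < 3), (i.+1, j.+1) \in E |
  (j.+1, i.+1) \in E]) //; congr (_ && _).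
have [ij|ij] := eqVneq (i < 3) (j < 3).
  by rewrite (same_side_nadj h_bip) // !sideE // ij.
have [i3|i3] := ltnP i 3; have [j3|j3] := ltnP j 3.
- by rewrite i3 j3 in ij.
- by rewrite cross ?i3 // negbK (negbTE (Erev i j _)) ?i3 // orbF.
- by rewrite compl_edge_sym cross ?j3 // negbK (negbTE (Erev j i _)) ?j3.
- by rewrite ltnNge i3 ltnNge j3 in ij.
Qed.

(** The sides are read off from [g]: adjacency puts [a], [b], [c] opposite to it, and common
    neighbors put [d], [e], [f] with it. *)
Lemma pattern_induced E a b c d e f g (st := [:: a; b; c; d; e; f; g]) :
  uniq [:: a; b; c] -> uniq [:: d; e; f; g] -> h a g -> h b g -> h c g ->
  (exists x, h x d && h x g) -> (exists x, h x e && h x g) -> (exists x, h x f && h x g) ->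
  all (fun e => (e.1 <= 3) && (3 < e.2)) E ->
  (forall i j, i < 3 <= j -> j < 7 -> h (nth a st i) (nth a st j) = ((i.+1, j.+1) \notin E)) ->
  contains_induced G (clique34 E).
Proof.
move=> abc defg ag bg cg d_side e_side f_side E_bip cross.
apply: (@clique34_induced E [:: a; b; c] [:: d; e; f; g] a) => // x y xs yt.
have -> : (y \in A) = (g \in A).
  move: yt; rewrite !inE => /or4P[]/eqP->{y} //.
  - by have [z /andP[zd zg]] := d_side; exact: same_side zd zg.
  - by have [z /andP[ze zg]] := e_side; exact: same_side ze zg.
  - by have [z /andP[zf zg]] := f_side; exact: same_side zf zg.
by move: xs; rewrite !inE => /or3P[]/eqP->; exact: h_bip.
Qed.

(** Vertices of one clique are distinct because some vertex is adjacent for [h] to exactly one of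
    them; [congruence] finds it. *)
Ltac solve_pattern :=
  repeat match goal with H : is_true (~~ _) |- _ => move/negbTE in H end;
  unfold is_true in *;
  first [ by move=> [|[|[|i]]] [|[|[|[|[|[|[|j]]]]]]] //= _ _; assumption
        | rewrite /= !inE !negb_or; do !(apply/andP; split) => //;
          apply/eqP => E; congruence ].

Lemma pattern1_induced a b c d e f g : pattern1 h a b c d e f g -> contains_induced G G1.
Proof.
case/and5P => ad ae af ag /and5P[bd be bf bg /and4P[cd ce cf cg]].
apply: (@pattern_induced _ a b c d e f g) => //; try by solve_pattern.
- by exists b; apply/andP.
- by exists a; apply/andP.
- by exists a; apply/andP.
Qed.

Lemma pattern2_induced a b c d e f g : pattern2 h a b c d e f g -> contains_induced G G2.
Proof.
case/and5P => ad ae af ag /and5P[bd be bf bg /and4P[cd ce cf cg]].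
apply: (@pattern_induced _ a b c d e f g) => //; try by solve_pattern.
- by exists a; apply/andP.
- by exists a; apply/andP.
- by exists a; apply/andP.
Qed.

Lemma pattern3_induced a b c d e f g : pattern3 h a b c d e f g -> contains_induced G G3.
Proof.
case/and5P => ad ae af ag /and5P[bd be bf bg /and4P[cd ce cf cg]].
apply: (@pattern_induced _ a b c d e f g) => //; try by solve_pattern.
- by exists a; apply/andP.
- by exists c; apply/andP.
- by exists b; apply/andP.
Qed.

End Embeddings.

(** * Co-bipartite circle graphs *)

Theorem corollary8p1 (R : realType) (G : sgraph) :
  cobipartite G ->
  (circle_graph R G <-> ~ exists H : sgraph, Gcop H /\ contains_induced G H).
Proof.
move=> cobip; split=> [/circle_graph_overlap[l [r model]] [H [GH]]|free].
  case: H / GH => [k k3|||].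
  - exact (cocycle_not_induced model cobip k3).
  - exact: G1_not_induced model cobip.
  - exact: G2_not_induced model cobip.
  - exact: G3_not_induced model cobip.
have [A bip] : exists A : {set G}, forall x y, compl_edge x y -> (x \in A) != (y \in A).
  by case: cobip => A bip; exists A.
have no_hole n f : 5 <= n -> ~ is_hole (@compl_edge G) n f.
  move=> n5 hole; apply: free; exists (compl (cycle_graph n)); split; last exact: hole_induced hole.
  (* Holes of a bipartite graph are even, so only complements of even cycles are needed. *)
  have nE : n = 2 * n./2 by rewrite mul2n even_halfK // (hole_even bip n5 hole).
  by rewrite nE; constructor; move: nE n5; clear; lia.
have no1 a b c d e f g : ~~ pattern1 (@compl_edge G) a b c d e f g.
  by apply/negP => /(pattern1_induced bip) ind; apply: free; exists G1; split=> //; constructor.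
have no2 a b c d e f g : ~~ pattern2 (@compl_edge G) a b c d e f g.
  by apply/negP => /(pattern2_induced bip) ind; apply: free; exists G2; split=> //; constructor.
have no3 a b c d e f g : ~~ pattern3 (@compl_edge G) a b c d e f g.
  by apply/negP => /(pattern3_induced bip) ind; apply: free; exists G3; split=> //; constructor.
have [l [r [lr lrE]]] := merge_model (@compl_edge_sym G) bip no_hole no1 no2 no3.
apply: (@overlap_circle_graph R G (fun v => (l v)%:R%R) (fun v => (r v)%:R%R)).
split=> [v|u v uv]; first by rewrite ltr_nat.
by rewrite adjE uv lrE // /overlap !ler_nat.
Qed.
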